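(* Every Banach space (over $\mathbb{R}$ or $\mathbb{C}$) admitting a Schauder decomposition is non-Lotz; that is, it carries a $C_0$-semigroup that is not uniformly continuous.
   Context: A Schauder decomposition of a Banach space $X$ is a sequence $(X_n)_{n\in\mathbb{N}}$ of nonzero closed subspaces of $X$ such that every $x\in X$ has a unique representation $x=\sum_{n=1}^\infty x_n$ with $x_n\in X_n$ for all $n$, the series converging in norm. The coordinate maps $Q_nx=x_n$ and the partial-sum projections $P_N=\sum_{n=1}^N Q_n$ are bounded. A $C_0$-semigroup on $X$ is a family $(T(t))_{t\ge 0}$ of bounded linear operators with $T(0)=I_X$, $T(t+s)=T(t)T(s)$ for $t,s\ge 0$, and $\lim_{t\downarrow 0}\|T(t)x-x\|=0$ for every $x\in X$. It is uniformly continuous if $\lim_{t\downarrow 0}\|T(t)-I_X\|=0$ in operator norm. $X$ is non-Lotz if at least one $C_0$-semigroup on $X$ is not uniformly continuous. *)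

(* Defs.v *)
From HB Require Import structures.
From mathcomp Require Import all_boot all_order all_algebra complex.
From mathcomp Require Import boolp classical_sets functions reals ereal.
From mathcomp Require Import topology normedtype sequences.

Set Implicit Arguments.
Unset Strict Implicit.
Unset Printing Implicit Defensive.

Import Order.TTheory GRing.Theory Num.Theory.
Import numFieldNormedType.Exports.

Local Open Scope classical_set_scope.
Local Open Scope ring_scope.

Definition schauder_decomposition (K : numFieldType)
    (X : completeNormedModType K) (A : nat -> set X) : Prop :=
  (forall n, [/\ closed (A n), submod_closed [in A n] &
                 exists2 x, A n x & x != 0]) /\
  (forall x : X, exists! u : nat -> X,
     (forall n, A n (u n)) /\ series u @ \oo --> x).

(* The norm of a K-normed module takes its values in K. To treat R and R[i] at
   once, the definitions involving an operator norm are parameterized by a map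
   re : K -> R, meant to be the identity for K = R and the real part for
   K = R[i] (where norms are real, so that nothing is lost). *)
Definition opnorm (R : realType) (K : numFieldType) (re : K -> R)
    (X : normedModType K) (f : X -> X) : \bar R :=
  ereal_sup [set (re `|f x|)%:E | x in [set x : X | `|x| <= 1]].

(* Operators at negative times are unconstrained. *)
Definition C0_semigroup (R : realType) (K : numFieldType)
    (X : normedModType K) (T : R -> {linear X -> X}) : Prop :=
  [/\ forall t : R, 0 <= t -> bounded_near (T t) (nbhs (0 : X)),
      forall x, T 0 x = x,
      forall t s : R, 0 <= t -> 0 <= s -> forall x, T (t + s) x = T t (T s x) &
      forall x, T t x @[t --> (0 : R)^'+] --> x].

Definition uniformly_continuous_semigroup (R : realType) (K : numFieldType)
    (re : K -> R) (X : normedModType K) (T : R -> {linear X -> X}) : Prop :=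
  opnorm re (fun x => T t x - x) @[t --> (0 : R)^'+] --> 0%E.

Definition non_Lotz (R : realType) (K : numFieldType) (re : K -> R)
    (X : completeNormedModType K) : Prop :=
  exists T : R -> {linear X -> X},
    C0_semigroup T /\ ~ uniformly_continuous_semigroup re T.

(* Main.v *)
From HB Require Import structures.
Require Import Defs.
From mathcomp Require Import all_boot all_order all_algebra complex.
From mathcomp Require Import boolp classical_sets functions reals ereal.
From mathcomp Require Import topology normedtype sequences realfun exp.
From mathcomp Require Import ring.

Set Implicit Arguments.
Unset Strict Implicit.
Unset Printing Implicit Defensive.

Import Order.TTheory GRing.Theory Num.Theory.
Import numFieldNormedType.Exports.

Local Open Scope classical_set_scope.
Local Open Scope ring_scope.

(** Let [Q_n] be the coordinate maps of a Schauder decomposition and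
    [P_N = sum_(n < N) Q_n]. The semigroup is diagonal:
    [T(t) x = sum_n e^(- n t) Q_n x]. Everything rests on summation by parts: for
    nonnegative nonincreasing weights [c_n], the sums [sum_(n < N) c_n x_n] are
    combinations of the partial sums of [x_n] with nonnegative coefficients of
    total mass [c_0]. Hence the series defining [T(t) x] converges, its tails
    are bounded by those of [sum_n Q_n x] uniformly in [t], which gives strong
    continuity at 0, and [|T(t) x|] is at most [sup_N |P_N x|]. The semigroup law
    is read off the coordinates. On the nonzero subspace [X_n], [T(t) - I] is
    multiplication by [e^(- n t) - 1], which tends to -1 as [n] grows; so
    [|T(t) - I|] does not tend to 0 as [t] does.

    Boundedness of [T(t)] then requires a constant [M] with
    [|P_N x| <= M |x|] for all [x] and [N]. This is the open mapping argument for
    the identity map from [X] normed by [|||x||| = sup_N |P_N x|] onto [X]: by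
    category, balls of [|||.|||] are dense in balls of [X]
    ([approximation_by_bounded]); successive approximation writes [x] as the
    limit of a sequence that is Cauchy for [|||.|||]; and [|||.|||] is complete
    because the subspaces are closed and expansions are unique
    ([partial_sums_complete]).

    Real and complex scalars are treated together, over a numeric field [K] with
    an order embedding [iota] of the reals whose image contains the nonnegative
    elements of [K], in particular all norms. *)

(** * Summation by parts and limits with a rate *)

Section SequenceEstimates.
Variables (K : numFieldType) (X : completeNormedModType K).
Implicit Types (a u : nat -> X) (r : nat -> K).

Lemma norm_cvg_le a (l : X) (M : K) :
  a @ \oo --> l -> (forall n, `|a n| <= M) -> `|l| <= M.
Proof.
move=> al aM; have M_real : M \is Num.real.
  by rewrite ger0_real// (le_trans _ (aM 0%N)).
rewrite real_leNgt ?normr_real//; apply/negP => Ml.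
have d_gt0 : 0 < `|l| - M by rewrite subr_gt0.
have /cvgrPdist_lt/(_ _ d_gt0)[n _ /(_ n (leqnn n)) /= ln] := al.
have := le_lt_trans (lerB_dist l (a n)) ln.
by rewrite ltrD2l ltrN2 => /lt_le_trans/(_ (aM n)); rewrite ltxx.
Qed.

Lemma norm_cvg_tail a (l : X) n (e : K) : a @ \oo --> l ->
  (forall k, `|a (n + k)%N - a n| <= e) -> `|l - a n| <= e.
Proof.
move=> al ae; apply: (@norm_cvg_le (fun k => a (k + n)%N - a n)).
  by apply: cvgB; [rewrite cvg_shiftn|exact: cvg_cst].
by move=> k; rewrite addnC.
Qed.

(** The rate [r] of the Cauchy property is also a rate of convergence. *)
Lemma cvg_of_modulus a r :
  (forall n k, `|a (n + k)%N - a n| <= r n) ->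
  (forall e, 0 < e -> exists n, r n < e) ->
  exists2 l, a @ \oo --> l & forall n, `|l - a n| <= r n.
Proof.
move=> ar r0; have ca : cvgn a.
  apply: cauchy_cvg; apply: cauchy_exP => e /r0[n rne].
  exists (a n), n => // m /= /subnKC <-.
  by rewrite -ball_normE /ball_/= distrC (le_lt_trans (ar _ _)).
by exists (limn a) => // n; exact: norm_cvg_tail.
Qed.

Lemma cvg_modulus a (l : X) : a @ \oo --> l ->
  forall e : K, 0 < e -> exists n, forall k, `|a (n + k)%N - a n| <= e.
Proof.
move=> al e e0; have e20 : 0 < e / 2 by rewrite divr_gt0.
have /cvgrPdist_le/(_ _ e20)[n _ nP] := al.
exists n => k; rewrite (le_trans (ler_distD l _ _))// (splitr e) lerD//.
  by rewrite distrC; apply: nP => /=; exact: leq_addr.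
by apply: nP => /=.
Qed.

(** Summation by parts expresses the weighted sum through the partial sums of
    [u], with nonnegative coefficients adding up to [c 0]. *)
Lemma abel_inequality (c : nat -> K) u (M : K) :
    (forall n, 0 <= c n) -> (forall n, c n.+1 <= c n) ->
    (forall n, `|series u n| <= M) ->
  forall n, `|series (fun k => c k *: u k) n| <= c 0%N * M.
Proof.
move=> c0 cS uM n.
(* The difference is the sum of the (c k - c k.+1) *: series u k.+1 for k < n. *)
have key : `|series (fun k => c k *: u k) n - c n *: series u n|
    <= (c 0%N - c n) * M.
  elim: n => [|n IHn].
    by rewrite /series/= !big_geq// scaler0 !subrr normr0 mul0r.
  rewrite seriesSr [in X in X <= _](_ : _ - _ =
    (series (fun k => c k *: u k) n - c n *: series u n)
     + (c n - c n.+1) *: series u n.+1); last first.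
    by rewrite scalerBl addrA; congr (_ - _);
      rewrite !seriesSr scalerDr addrA subrK.
  rewrite (le_trans (ler_normD _ _))// -[c 0%N - c n.+1](subrKA (c n)) mulrDl.
  by rewrite lerD// normrZ ger0_norm ?ler_wpM2l ?subr_ge0.
rewrite -[X in `|X|](subrK (c n *: series u n)) (le_trans (ler_normD _ _))//.
rewrite -(subrK (c n) (c 0%N)) mulrDl lerD// normrZ ger0_norm//.
by rewrite ler_wpM2l.
Qed.

Lemma series_tailE u n k :
  series u (n + k)%N - series u n = series (fun i => u (n + i)%N) k.
Proof.
rewrite sub_series_geq ?leq_addr// /series/= -{1}[n]add0n big_addn addKn.
by apply: eq_bigr => i _; rewrite addnC.
Qed.

(** The bound depends on [c] through [c n] only, so it is uniform over a family
    of weights that are at most 1. *)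
Lemma abel_tail (c : nat -> K) u (n : nat) (e : K) :
    (forall k, 0 <= c k) -> (forall k, c k.+1 <= c k) ->
    (forall k, `|series u (n + k)%N - series u n| <= e) ->
  forall k, `|series (fun i => c i *: u i) (n + k)%N
              - series (fun i => c i *: u i) n| <= c n * e.
Proof.
move=> c0 cS ue k; rewrite series_tailE -[n in leRHS]addn0.
apply: (abel_inequality (c := fun i => c (n + i)%N)) => // [i|i].
  by rewrite addnS.
by rewrite -series_tailE.
Qed.

Lemma nonincreasing_le0 (c : nat -> K) :
  (forall k, c k.+1 <= c k) -> forall n, c n <= c 0%N.
Proof. by move=> cS; elim=> // n; exact: le_trans. Qed.

Lemma abel_test (c : nat -> K) u (l : X) :
    (forall k, 0 <= c k) -> (forall k, c k.+1 <= c k) ->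
    series u @ \oo --> l -> cvgn (series (fun i => c i *: u i)).
Proof.
move=> c0 cS ul; apply: cauchy_cvg; apply: cauchy_exP => e e0.
have c1_gt0 : 0 < c 0%N + 1 by rewrite ltr_pwDr.
have [n nP] := cvg_modulus ul (divr_gt0 e0 c1_gt0).
exists (series (fun i => c i *: u i) n), n => // m /= /subnKC <-.
rewrite -ball_normE /ball_/= distrC (le_lt_trans (abel_tail c0 cS nP _))//.
rewrite mulrCA -[ltRHS]mulr1 ltr_pM2l// ltr_pdivrMr// mul1r.
by rewrite (le_lt_trans (nonincreasing_le0 cS n))// ltrDl.
Qed.

End SequenceEstimates.

(** * A category argument *)

Section Baire.
Variables (K : numFieldType) (X : completeNormedModType K).
Hypothesis archK : forall x : K, 0 <= x -> exists n, x <= n%:R.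

Lemma exp_half_small (c e : K) : 0 <= c -> 0 < e -> exists n, c / 2 ^+ n < e.
Proof.
move=> c0 e0; have [n nP] := archK (divr_ge0 c0 (ltW e0)).
exists n; rewrite ltr_pdivrMr ?exprn_gt0// mulrC -ltr_pdivrMr//.
by rewrite (le_lt_trans nP)// -natrX ltr_nat ltn_expl.
Qed.

(** If every [F n] missed a ball inside each ball, nested balls of radii tending
    to 0, the successive ones avoiding [F 0], [F 1], and so on, would shrink to a
    point in no [F n]. *)
Lemma baire_cover (F : nat -> set X) : (forall x, exists n, F n x) ->
  exists n x (r : K), 0 < r /\ forall y, `|y - x| < r ->
    forall e : K, 0 < e -> exists2 z, F n z & `|y - z| < e.
Proof.
move=> Fcover; apply: contrapT => nodense.
have step (p : nat * (X * {posnum K})) : exists q : X * {posnum K},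
    [/\ `|q.1 - p.2.1| + q.2%:num <= p.2.2%:num, q.2%:num <= p.2.2%:num / 2
      & forall z, `|z - q.1| <= q.2%:num -> ~ F p.1 z].
  case: p => n [x r] /=; apply: contrapT => nq; apply: nodense.
  exists n, x, (r%:num / 2); split => // y yx e e0; apply: contrapT => nz.
  apply: nq.
  have cmp : e / 2 >=< r%:num / 2.
    by rewrite real_comparable ?gtr0_real ?divr_gt0.
  have m0 : 0 < Num.min (e / 2) (r%:num / 2).
    by rewrite comparable_lt_min ?divr_gt0.
  exists (y, PosNum m0); split => /=.
  - by rewrite [leRHS]splitr lerD ?(ltW yx)// comparable_ge_min// lexx orbT.
  - by rewrite comparable_ge_min// lexx orbT.
  - move=> z zy Fz; apply: nz; exists z => //.
    rewrite distrC (le_lt_trans zy)// comparable_gt_min//.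
    by rewrite ltr_pdivrMr// ltr_pMr// ltr1n.
have [f fP] := choice step.
pose ball := fix ball n : X * {posnum K} :=
  if n is m.+1 then f (m, ball m) else (0, PosNum ltr01).
pose a n := (ball n).1; pose r n := (ball n).2%:num.
have aS n : `|a n.+1 - a n| + r n.+1 <= r n by have [] := fP (n, ball n).
have rS n : r n.+1 <= r n / 2 by have [] := fP (n, ball n).
have aF n z : `|z - a n.+1| <= r n.+1 -> ~ F n z.
  by have [_ _] := fP (n, ball n); apply.
(* This form of nesting survives composition by the triangle inequality, and
   bounds the distance between centers. *)
have nested n k : `|a (n + k)%N - a n| + r (n + k)%N <= r n.
  elim: k => [|k IHk]; first by rewrite addn0 subrr normr0 add0r.
  rewrite addnS (le_trans _ IHk)// (le_trans _ (lerD (lexx _) (aS _)))//.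
  rewrite addrA lerD2r addrC.
  exact: ler_distD.
have rexp n : r n <= 1 / 2 ^+ n.
  elim: n => [|n IHn]; first by rewrite expr0 divr1.
  rewrite (le_trans (rS n))// exprSr invfM mulrA.
  by rewrite ler_wpM2r.
have [|e e0|l _ la] := @cvg_of_modulus _ _ a r.
- by move=> n k; rewrite (le_trans _ (nested n k))// lerDl /r ltW.
- have [n nP] := exp_half_small ler01 e0.
  by exists n; rewrite (le_lt_trans (rexp n)).
have [n Fnl] := Fcover l.
exact: (aF n l).
Qed.

End Baire.

(** * Uniform boundedness of the partial sums *)

Section Decomposition.
Variables (K : numFieldType) (X : completeNormedModType K).
Variable A : nat -> set X.
Hypothesis decA : schauder_decomposition A.

Definition scoord (x : X) : nat -> X := proj1_sig (cid (decA.2 x)).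

Lemma scoordP x : (forall n, A n (scoord x n)) /\ series (scoord x) @ \oo --> x.
Proof. by rewrite /scoord; case: cid => u /= []. Qed.

Lemma scoordE x u :
  (forall n, A n (u n)) -> series u @ \oo --> x -> scoord x = u.
Proof.
by rewrite /scoord; case: cid => v /= [_ uniq] Au ux; apply: uniq.
Qed.

Lemma component_linear n a x y : A n x -> A n y -> A n (a *: x + y).
Proof.
have [_ [_ lin] _] := decA.1 n; move=> Ax Ay.
by have := lin a x y; rewrite !inE; apply.
Qed.

Lemma component0 n : A n 0.
Proof. by have [_ [+ _] _] := decA.1 n; rewrite inE. Qed.

Lemma componentZ n a x : A n x -> A n (a *: x).
Proof.
move=> Ax; rewrite -[_ *: _]addr0.
by apply: component_linear; last exact: component0.
Qed.

Lemma scoord_linear a x y n : scoord (a *: x + y) n = a *: scoord x n + scoord y n.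
Proof.
have [Ax cx] := scoordP x; have [Ay cy] := scoordP y.
rewrite (@scoordE _ (a *: scoord x + scoord y))// => [k|].
  exact: component_linear.
by rewrite seriesD seriesZ; apply: cvgD => //; exact: cvgZl_tmp.
Qed.

Lemma series_scoord_linear a x y n :
  series (scoord (a *: x + y)) n = a *: series (scoord x) n + series (scoord y) n.
Proof.
rewrite /series/= scaler_sumr -big_split/=; apply: eq_bigr => k _.
exact: scoord_linear.
Qed.

Lemma series_scoordB x y n :
  series (scoord (x - y)) n = series (scoord x) n - series (scoord y) n.
Proof. by rewrite addrC -scaleN1r series_scoord_linear scaleN1r addrC. Qed.

Lemma series_scoord0 n : series (scoord 0) n = 0.
Proof. by rewrite -[X in scoord X](subrr 0) series_scoordB subrr. Qed.

Lemma series_scoordZ a x n : series (scoord (a *: x)) n = a *: series (scoord x) n.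
Proof. by rewrite -[_ *: x]addr0 series_scoord_linear series_scoord0 addr0. Qed.

Lemma scoord_component n x : A n x -> scoord x = fun k => if k == n then x else 0.
Proof.
move=> Ax; apply: scoordE => [k|].
  by have [->|_] := eqVneq k n; last exact: component0.
apply: cvg_near_cst; exists n.+1 => // k /= nk; rewrite /series/=.
rewrite big_mkord (bigD1 (Ordinal nk))//= eqxx big1 ?addr0// => i /negPf.
by rewrite -val_eqE/= => ->.
Qed.

(** Completeness of [sup_n |P_n x|]. The limits [z n] of [P_n (g j)] in [j] have
    increments in the components, which are closed; the uniformity in [n] lets the
    limits in [j] and [n] be exchanged, so [z] tends to [x]; by uniqueness of the
    expansion of [x], [z n] is [P_n x]. *)
Lemma partial_sums_complete (g : nat -> X) x (r : nat -> K) :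
    g @ \oo --> x ->
    (forall n j k,
      `|series (scoord (g (j + k)%N)) n - series (scoord (g j)) n| <= r j) ->
    (forall e, 0 < e -> exists j, r j < e) ->
  forall n j, `|series (scoord x) n - series (scoord (g j)) n| <= r j.
Proof.
move=> gx gr r0.
have lim_ex n : exists z, (fun j => series (scoord (g j)) n) @ \oo --> z /\
    forall j, `|z - series (scoord (g j)) n| <= r j.
  by have [z] := cvg_of_modulus (fun j k => gr n j k) r0; exists z.
have [z zP] := choice lim_ex.
pose u n := z n.+1 - z n.
have Au n : A n (u n).
  have [clA _ _] := decA.1 n.
  apply: (@closed_cvg _ _ \oo _ (fun j => scoord (g j) n) (A n)) => //.
    by apply: nearW => j; exact: (scoordP (g j)).1.
  rewrite (_ : (fun j => _) = (fun j => series (scoord (g j)) n.+1)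
     - (fun j => series (scoord (g j)) n)); last first.
    by apply/funext => j; rewrite fctE seriesSB.
  by apply: cvgB; [exact: (zP n.+1).1|exact: (zP n).1].
have z0 : z 0%N = 0.
  have [+ _] := zP 0%N.
  rewrite (_ : (fun j => _) = cst 0); last first.
    by apply/funext => j; rewrite /series/= big_geq.
  by move=> /(cvg_unique (@norm_hausdorff _ _) (cvg_cst _)).
have su n : series u n = z n by rewrite /series/= telescope_sumr// z0 subr0.
have zx : z @ \oo --> x.
  apply/cvgrPdist_lt => e e0; have e40 : 0 < e / 4 by rewrite divr_gt0.
  have [j1 j1P] := r0 _ e40.
  have /cvgrPdist_lt/(_ _ e40)[j2 _ j2P] := gx.
  near \oo => j.
  have [rj gj] : r j1 < e / 4 /\ `|x - g j| < e / 4.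
    by split=> //; apply: j2P => /=; near: j; exact: nbhs_infty_ge.
  have /cvgrPdist_lt/(_ _ e40) gjP := (scoordP (g j)).2.
  have j1j : (j1 <= j)%N by near: j; exact: nbhs_infty_ge.
  near=> n.
  have gn : `|g j - series (scoord (g j)) n| < e / 4 by near: n.
  have zn : `|series (scoord (g j)) n - z n| < e / 4 + e / 4.
    rewrite (le_lt_trans (ler_distD (series (scoord (g j1)) n) _ _))//.
    apply: ltrD; apply: le_lt_trans rj; last by rewrite distrC; exact: (zP n).2.
    by rewrite -(subnKC j1j); exact: gr.
  rewrite (le_lt_trans (ler_distD (g j) _ _))//.
  rewrite (_ : e = e / 4 + (e / 4 + (e / 4 + e / 4))); last first.
    by field.
  apply: ltrD => //.
  rewrite (le_lt_trans (ler_distD (series (scoord (g j)) n) _ _))//.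
  exact: ltrD.
move=> n j; rewrite (scoordE Au) ?su; first exact: (zP n).2.
by rewrite (_ : series u = z)//; exact/funext.
Unshelve. all: by end_near. Qed.

Hypothesis archK : forall x : K, 0 <= x -> exists n, x <= n%:R.

Lemma pointwise_bounded_partial_sums x :
  exists k, forall n, `|series (scoord x) n| <= k%:R.
Proof.
have [n nP] := cvg_modulus (scoordP x).2 ltr01.
have : 0 <= 1 + `|series (scoord x) n| + \sum_(i < n) `|series (scoord x) i|.
  by rewrite !addr_ge0 ?sumr_ge0.
move=> /archK[k kP]; exists k => m; rewrite (le_trans _ kP)//.
have [nm|mn] := leqP n m.
  rewrite -[leLHS]addr0 lerD ?sumr_ge0// -lerBlDr (le_trans (lerB_dist _ _))//.
  by rewrite -(subnKC nm).
rewrite (bigD1 (Ordinal mn))//= addrCA -[leLHS]addr0 lerD//.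
by rewrite !addr_ge0// sumr_ge0.
Qed.

(** The vectors whose partial sums are bounded by [k] are dense in some
    ball for some [k]. Subtracting two approximations moves the ball to the
    origin at the cost of doubling [k], and homogeneity gives all radii. *)
Lemma approximation_by_bounded : exists2 D : K, 0 <= D &
  forall (y : X) (s : K), 0 < s -> `|y| <= s -> exists2 f, `|y - f| <= s / 2 &
    forall n, `|series (scoord f) n| <= D * s.
Proof.
pose F k := [set x | forall n, `|series (scoord x) n| <= k%:R].
have [k [x0 [r [r0 dense]]]] :=
  baire_cover archK (F := F) pointwise_bounded_partial_sums.
exists (2 * (k%:R + k%:R) / r) => [|y s s0 ys].
  by rewrite divr_ge0 ?mulr_ge0 ?addr_ge0// ltW.
(* The factor t brings y into the half-radius ball around the origin. *)
pose t := r / (2 * s); have t0 : 0 < t by rewrite divr_gt0 ?mulr_gt0.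
have e0 : 0 < t * s / 4 by rewrite divr_gt0 ?(mulr_gt0 t0).
have [|f1 F1 f1P] := dense (t *: y + x0) _ _ e0.
  rewrite addrK normrZ gtr0_norm//.
  rewrite (le_lt_trans (ler_wpM2l (ltW t0) ys))//.
  rewrite /t invfM mulrA divfK ?gt_eqF// ltr_pdivrMr// ltr_pMr// ltr1n//.
have [|f2 F2 f2P] := dense x0 _ _ e0; first by rewrite subrr normr0.
exists (t^-1 *: (f1 - f2)) => [|n].
  rewrite -[y](scalerK (lt0r_neq0 t0)) -scalerBr normrZ gtr0_norm ?invr_gt0//.
  rewrite ler_pdivrMl// opprB addrCA.
  rewrite [X in `|X|](_ : _ = (t *: y + x0 - f1) - (x0 - f2)); last first.
    by rewrite opprB [t *: y + x0 - f1]addrAC addrACA subrr addr0 addrC.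
  rewrite (le_trans (ler_normB _ _))// (le_trans (lerD (ltW f1P) (ltW f2P)))//.
  by rewrite le_eqVlt; apply/orP; left; apply/eqP; field.
rewrite series_scoordZ series_scoordB normrZ gtr0_norm ?invr_gt0//.
rewrite ler_pdivrMl// (le_trans (ler_normB _ _))//.
rewrite (le_trans (lerD (F1 n) (F2 n)))//.
rewrite le_eqVlt; apply/orP; left; apply/eqP; rewrite /t; field.
by rewrite !lt0r_neq0.
Qed.

(** Halving the remainder [y j] at each step writes [x] as the limit of [x - y j],
    a Cauchy sequence for the norm [sup_n |P_n .|], with a geometric rate. *)
Theorem partial_sums_bounded : exists2 M : K, 0 <= M &
  forall x n, `|series (scoord x) n| <= M * `|x|.
Proof.
have [D D0 approx] := approximation_by_bounded.
have approx' (p : X * K) : exists z, 0 < p.2 -> `|p.1| <= p.2 ->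
    `|p.1 - z| <= p.2 / 2 /\ forall n, `|series (scoord z) n| <= D * p.2.
  case: p => y s /=.
  have [s0|] := pselect (0 < s); last by exists 0.
  have [ys|] := pselect (`|y| <= s); last by exists 0.
  by have [f] := approx y s s0 ys; exists f.
have [f fP] := choice approx'.
exists (2 * D) => [|x n]; first by rewrite mulr_ge0.
have [->|x_neq0] := eqVneq x 0; first by rewrite series_scoord0 !normr0 mulr0.
pose s j := `|x| / 2 ^+ j.
have s0 j : 0 < s j by rewrite divr_gt0 ?exprn_gt0 ?normr_gt0.
have sS j : s j.+1 = s j / 2 by rewrite /s exprSr invfM mulrA.
pose y := fix y j := if j is i.+1 then y i - f (y i, s i) else x.
have ys j : `|y j| <= s j.
  elim: j => [|j IHj] /=; first by rewrite /s expr0 divr1.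
  have [yj _] := fP (y j, s j) (s0 j) IHj.
  by rewrite sS.
pose g j := x - y j.
have gS m j : `|series (scoord (g j.+1)) m - series (scoord (g j)) m| <= D * s j.
  rewrite -series_scoordB /g /= [X in scoord X](_ : _ = f (y j, s j)); last first.
    by rewrite !opprB !addrA subrK addrAC subrr add0r.
  by have [_] := fP (y j, s j) (s0 j) (ys j); apply.
(* The bound telescopes since s j = 2 (s j - s j.+1). *)
have gk m j k : `|series (scoord (g (j + k)%N)) m - series (scoord (g j)) m| <=
    2 * D * (s j - s (j + k)%N).
  elim: k => [|k IHk]; first by rewrite addn0 !subrr normr0 mulr0.
  rewrite addnS (le_trans (ler_distD (series (scoord (g (j + k)%N)) m) _ _))//.
  rewrite (le_trans (lerD (gS _ _) IHk))//.
  by rewrite sS le_eqVlt; apply/orP; left; apply/eqP; field.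
have := @partial_sums_complete g x (fun j => 2 * D * s j) _ _ _ n 0%N.
rewrite /g /= subrr series_scoord0 subr0 /s expr0 divr1; apply.
- apply/cvgrPdist_lt => e e0.
  have [J JP] := exp_half_small archK (normr_ge0 x) e0.
  exists J => // j /= Jj; rewrite /g opprB addrC subrK.
  rewrite (le_lt_trans (ys j))// (le_lt_trans _ JP)// ler_wpM2l//.
  by rewrite lef_pV2 ?posrE ?exprn_gt0// ler_weXn2l// ler1n.
- move=> m j k; rewrite (le_trans (gk m j k))// ler_wpM2l ?mulr_ge0//.
  by rewrite gerBl ltW.
- move=> e e0.
  have [|j jP] := exp_half_small archK (c := 2 * D * `|x|) _ e0.
    by rewrite !mulr_ge0.
  by exists j; rewrite mulrA.
Qed.
End Decomposition.

(** * Diagonal operators *)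

Section Multiplier.
Variables (K : numFieldType) (X : completeNormedModType K).
Variable A : nat -> set X.
Hypothesis decA : schauder_decomposition A.
Implicit Types (c d : nat -> K) (x y : X).

Definition nonincreasing_weights c :=
  (forall n, 0 <= c n) /\ (forall n, c n.+1 <= c n).

Definition multiplier c x : X := limn (series (fun n => c n *: scoord decA x n)).

Lemma multiplier_series c x : nonincreasing_weights c ->
  series (fun n => c n *: scoord decA x n) @ \oo --> multiplier c x.
Proof. by case=> c0 cS; apply: (abel_test c0 cS (scoordP decA x).2). Qed.

Lemma scoord_multiplier c x : nonincreasing_weights c ->
  scoord decA (multiplier c x) = fun n => c n *: scoord decA x n.
Proof.
move=> cw; apply: scoordE; last exact: multiplier_series.
by move=> n; apply: (componentZ decA); exact: (scoordP decA x).1.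
Qed.

Lemma scoord_inj x y : scoord decA x = scoord decA y -> x = y.
Proof.
move=> xy; have := (scoordP decA x).2; rewrite xy => xl.
exact: (cvg_unique (@norm_hausdorff _ _) xl (scoordP decA y).2).
Qed.

Lemma multiplier_linear c : nonincreasing_weights c -> linear (multiplier c).
Proof.
move=> cw a x y; apply: scoord_inj; apply/funext => n.
rewrite scoord_linear !scoord_multiplier// scoord_linear.
by rewrite scalerDr !scalerA mulrC.
Qed.

Lemma multiplier1 x : multiplier (fun=> 1) x = x.
Proof.
rewrite /multiplier (_ : (fun n => _) = scoord decA x).
  by apply: cvg_lim; [exact: norm_hausdorff|exact: (scoordP decA x).2].
by apply/funext => n; rewrite scale1r.
Qed.

Lemma multiplierM c d x : nonincreasing_weights c -> nonincreasing_weights d ->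
  nonincreasing_weights (fun n => c n * d n) ->
  multiplier (fun n => c n * d n) x = multiplier c (multiplier d x).
Proof.
move=> cw dw cdw; apply: scoord_inj; rewrite !scoord_multiplier//.
by apply/funext => n; rewrite scalerA.
Qed.

Lemma multiplier_component c n x : nonincreasing_weights c -> A n x ->
  multiplier c x = c n *: x.
Proof.
move=> cw Ax; apply: scoord_inj; rewrite scoord_multiplier//.
rewrite (scoord_component _ Ax) (scoord_component decA (componentZ decA _ Ax)).
by apply/funext => k; case: eqP => [->//|_]; rewrite scaler0.
Qed.

Lemma multiplier_bound c x (C : K) : nonincreasing_weights c ->
  (forall n, `|series (scoord decA x) n| <= C) ->
  `|multiplier c x| <= c 0%N * C.
Proof.
move=> cw xC. apply: (norm_cvg_le (multiplier_series cw)) => n.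
exact: abel_inequality cw.1 cw.2 xC n.
Qed.

(** Split the sum at an [n] past which the tails of the expansion of [x] are
    small: by Abel summation the tails of the weighted sums are as small for all
    [t], and the finite sums converge. *)
Lemma multiplier_cvg_id (T : Type) (F : set_system T) (c : T -> nat -> K) x :
    ProperFilter F ->
    (forall t, nonincreasing_weights (c t) /\ c t 0%N <= 1) ->
    (forall n, c t n @[t --> F] --> (1 : K)) ->
  multiplier (c t) x @[t --> F] --> x.
Proof.
move=> PF cw c1; apply/cvgrPdist_lt => e e0.
have e40 : 0 < e / 4 by rewrite divr_gt0.
have [n nP] := cvg_modulus (scoordP decA x).2 e40.
have xn := norm_cvg_tail (scoordP decA x).2 nP.
have cn : series (fun k => c t k *: scoord decA x k) n @[t --> F]
    --> series (scoord decA x) n.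
  elim: n {nP xn} => [|n IHn].
    rewrite [series _ 0%N]big_geq//.
    under eq_cvg do rewrite /series/= big_geq//.
    exact: cvg_cst.
  rewrite seriesSr; under eq_cvg do rewrite seriesSr.
  apply: cvgD => //.
  by rewrite -[X in _ --> X]scale1r; exact: cvgZr_tmp.
have /cvgrPdist_lt/(_ _ e40) := cn; apply: filterS => t tn.
have [ctw ct1] := cw t.
have Tn : `|multiplier (c t) x - series (fun k => c t k *: scoord decA x k) n|
    <= e / 4.
  apply: (norm_cvg_tail (multiplier_series ctw)) => k.
  rewrite (le_trans (abel_tail ctw.1 ctw.2 nP k))// ler_piMl ?(ltW e40)//.
  exact: le_trans (nonincreasing_le0 ctw.2 n) ct1.
rewrite (le_lt_trans (ler_distD (series (scoord decA x) n) _ _))//.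
rewrite (_ : e = e / 4 + (e / 4 + (e / 4 + e / 4))); last by field.
apply: ler_ltD => //.
rewrite (le_lt_trans
  (ler_distD (series (fun k => c t k *: scoord decA x k) n) _ _))//.
by apply: ltr_leD => //; rewrite distrC (le_trans Tn)// lerDl ltW//.
Qed.

End Multiplier.

(** * The diagonal semigroup *)

Section Semigroup.
Variables (R : realType) (K : numFieldType) (iota : {rmorphism R -> K}).
Variable re : K -> R.
Hypothesis iota_le : {mono iota : x y / x <= y}.
Hypothesis iota_re : forall x : K, 0 <= x -> iota (re x) = x.
Variables (X : completeNormedModType K) (A : nat -> set X).
Hypothesis decA : schauder_decomposition A.

Let iota_lt : {mono iota : x y / x < y} := leW_mono iota_le.

Lemma re_iota (x : R) : 0 <= x -> re (iota x) = x.
Proof.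
by move=> x0; apply: (fmorph_inj iota); rewrite iota_re// -(rmorph0 iota) iota_le.
Qed.

Lemma archimedean_of_real (x : K) : 0 <= x -> exists n, x <= n%:R.
Proof.
move=> x0; exists (Num.truncn (re x)).+1.
by rewrite -{1}(iota_re x0) -(rmorph_nat iota) iota_le ltW// truncnS_gt.
Qed.

Lemma iota_norm (x : R) : `|iota x| = iota `|x|.
Proof.
have [x0|/ltW x0] := leP 0 x.
  by rewrite !ger0_norm// -(rmorph0 iota) iota_le.
rewrite (ler0_norm x0) rmorphN ler0_norm//.
by rewrite -(rmorph0 iota) iota_le.
Qed.

Lemma iota_continuous : continuous (iota : R -> K).
Proof.
move=> x; apply/cvgrPdist_lt => e e0.
have iotae : iota (re e) = e by rewrite iota_re// ltW.
have re0 : 0 < re e by rewrite -iota_lt rmorph0 iotae.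
have /cvgrPdist_lt/(_ _ re0) : y @[y --> x] --> x by exact: cvg_id.
by apply: filterS => y xy; rewrite -rmorphB iota_norm -iotae iota_lt.
Qed.

(** The absolute value keeps the base in (0, 1] at negative times, so that the
    diagonal operators are defined there as well. *)
Definition weight (t : R) (n : nat) : K := iota (expR (- `|t|) ^+ n).

Lemma weight_nonincreasing t : nonincreasing_weights (weight t).
Proof.
split=> n; rewrite /weight.
  by rewrite -(rmorph0 iota) iota_le exprn_ge0// expR_ge0.
by rewrite iota_le exprS ler_piMl ?exprn_ge0 ?expR_ge0//.
Qed.

Lemma weight0 t : weight t 0 = 1.
Proof. by rewrite /weight expr0 rmorph1. Qed.

Definition semigroup (t : R) : {linear X -> X} :=
  HB.pack (multiplier decA (weight t))
    (GRing.isLinear.Build _ _ _ _ _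
      (multiplier_linear decA (weight_nonincreasing t))).

Lemma semigroup_bounded : exists2 M : K, 0 <= M &
  forall t x, `|semigroup t x| <= M * `|x|.
Proof.
have [M M0 xM] := partial_sums_bounded decA archimedean_of_real.
exists M => // t x; rewrite -[leRHS]mul1r -(weight0 t).
by apply: (multiplier_bound (weight_nonincreasing t)) => n; exact: xM.
Qed.

Lemma weightD t s : 0 <= t -> 0 <= s ->
  weight (t + s) = fun n => weight t n * weight s n.
Proof.
move=> t0 s0; apply/funext => n; rewrite /weight -rmorphM -exprMn -expRD.
by rewrite !ger0_norm ?addr_ge0// opprD.
Qed.

Lemma weight_cvg1 n : weight t n @[t --> (0 : R)^'+] --> (1 : K).
Proof.
apply: cvg_at_right_filter.
have w0 : weight 0 n = 1 by rewrite /weight normr0 oppr0 expR0 expr1n rmorph1.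
rewrite -w0.
apply: (@continuous_cvg _ _ _ _ _ _ iota); first exact: iota_continuous.
apply: (@continuous_cvg _ _ _ _ _ _ (fun q : R => q ^+ n)).
  exact: exprn_continuous.
apply: (@continuous_cvg _ _ _ _ _ _ expR); first exact: continuous_expR.
apply: (@continuous_cvg _ _ _ _ _ _ (-%R)); first exact: oppr_continuous.
exact: norm_continuous.
Qed.

Lemma semigroup_C0 : C0_semigroup semigroup.
Proof.
have [M M0 TM] := semigroup_bounded.
split=> [t t0|x|t s t0 s0 x|x].
- exists M; split=> [|N MN]; first exact: ger0_real.
  apply/nbhs_normP; exists 1 => //= x /=; rewrite sub0r normrN => x1.
  by rewrite (le_trans (TM t x))// (le_trans _ (ltW MN))// ler_piMr// ltW.
- rewrite -[RHS](multiplier1 decA); congr (multiplier _ _ x).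
  by apply/funext => n; rewrite /weight normr0 oppr0 expR0 expr1n rmorph1.
- rewrite /= -multiplierM -?weightD//; exact: weight_nonincreasing.
- apply: multiplier_cvg_id weight_cvg1 => t; rewrite weight0.
  by split=> //; exact: weight_nonincreasing.
Qed.

(** A unit vector of [A n], for [n] such that [e^(- n t) <= 1/2], is moved by at
    least [1/2]. *)
Lemma opnorm_semigroup_ge t : 0 < t ->
  ((2^-1)%:E <= opnorm re (fun x => semigroup t x - x)%R)%E.
Proof.
move=> t0; have q1 : `|expR (- t)| < 1.
  by rewrite ger0_norm ?expR_ge0// -expR0 ltr_expR oppr_lt0.
have /cvgrPdist_le/(_ 2^-1) := cvg_expr q1.
rewrite invr_gt0 ltr0n => /(_ isT)[n _ /(_ n (leqnn n))].
rewrite sub0r normrN ger0_norm ?exprn_ge0 ?expR_ge0// => qn.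
have [_ _ [x Ax x0]] := decA.1 n.
pose v := `|x|^-1 *: x.
have v1 : `|v| = 1 by rewrite normrZ normfV normr_id mulVf// normr_eq0.
have Tv : semigroup t v - v = iota (expR (- t) ^+ n - 1) *: v.
  rewrite /= (multiplier_component _ (weight_nonincreasing t)
    (componentZ decA _ Ax)).
  by rewrite rmorphB rmorph1 scalerBl scale1r /weight gtr0_norm.
have : ((re `|semigroup t v - v|)%:E
    <= opnorm re (fun x => semigroup t x - x)%R)%E.
  by apply: ereal_sup_ubound; exists v => //=; rewrite v1.
apply: le_trans; rewrite Tv normrZ v1 mulr1 iota_norm re_iota// lee_fin distrC.
rewrite ger0_norm ?subr_ge0; last by rewrite (le_trans qn)// invf_le1// ler1n.
rewrite lerBrDr -lerBrDl (le_trans qn)//.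
by rewrite (_ : 1 - 2^-1 = 2^-1 :> R)//; field.
Qed.

Theorem non_Lotz_of_schauder : non_Lotz re X.
Proof.
exists semigroup; split; first exact: semigroup_C0.
move=> /(cvge_ge _) => /(_ (2^-1)%:E) H.
have : ((2^-1)%:E <= 0 :> \bar R)%E.
  apply: H; near=> t; apply: opnorm_semigroup_ge; near: t.
  exact: nbhs_right_gt.
by rewrite lee_fin leNgt invr_gt0 ltr0n.
Unshelve. all: by end_near. Qed.

End Semigroup.

Theorem proposition2p4 (R : realType) :
  (forall X : completeNormedModType R,
     (exists A : nat -> set X, schauder_decomposition A) ->
     non_Lotz (@idfun R) X) /\
  (forall X : completeNormedModType R[i],
     (exists A : nat -> set X, schauder_decomposition A) ->
     non_Lotz (@complex.Re R) X).
Proof.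
split=> X [A decA].
  exact: (@non_Lotz_of_schauder R R idfun _ _ _ _ _ decA).
apply: (@non_Lotz_of_schauder R R[i] (real_complex R) _ _ _ _ _ decA).
  exact: lecR.
by move=> x x0; exact: RRe_real (ger0_real x0).
Qed.
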